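(* Let $\varphi=\sum_{\lambda\in\Lambda}a_\lambda\operatorname{Hilb}(C_\lambda)\in\mathbb Q(t_1,\dots,t_n)$, where $\Lambda$ is finite, $a_\lambda\in\mathbb Q$, and each $C_\lambda$ is a pointed rational polyhedral cone with apex a lattice point $w_\lambda$. Suppose $\varphi\in\mathbb Q[t_1^{\pm1},\dots,t_n^{\pm1}]$, and let $P=\operatorname{Conv}\{w_\lambda:\lambda\in\Lambda\}$. Let $\boldsymbol\zeta\in\mathbb R^n$ (not necessarily irrational) and $b\in\mathbb R$, and suppose every cone $C_\lambda$ whose apex satisfies $\langle\boldsymbol\zeta,w_\lambda\rangle<b$ is $\boldsymbol\zeta$-pointed. Then \[ \varphi|_{H_{\boldsymbol\zeta=b}}=\sum_{\lambda:\ C_\lambda\ \boldsymbol\zeta\text{-pointed}}a_\lambda\operatorname{Hilb}(C_\lambda\cap H_{\boldsymbol\zeta=b}). \] In particular, if $P\cap H_{\boldsymbol\zeta=b}$ is the face $P^{-\boldsymbol\zeta}$ of $P$ minimizing $\langle\boldsymbol\zeta,\cdot\rangle$, then $\varphi|_{H_{\boldsymbol\zeta=b}}=\sum a_\lambda\operatorname{Hilb}(C_\lambda\cap H_{\boldsymbol\zeta=b})$, the sum over those $\lambda$ with $C_\lambda$ $\boldsymbol\zeta$-pointed and apex $w_\lambda\in P^{-\boldsymbol\zeta}$.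
   Context: Let $\mathcal P_n$ be the $\mathbb Q$-vector space of functions $\mathbb Z^n\to\mathbb Q$ spanned by indicator functions $\mathbf 1(P)$ of lattice polyhedra $P\subset\mathbb R^n$; identify $\mathbf 1(P)$ with the formal series $\sum_{\lambda\in P\cap\mathbb Z^n}\mathbf t^\lambda\in\mathbb Q[[t_1^{\pm1},\dots,t_n^{\pm1}]]$, making $\mathcal P_n$ a $\mathbb Q[\mathbf t^{\pm}]$-submodule. $\operatorname{Hilb}:\mathcal P_n\to\mathbb Q(t_1,\dots,t_n)$ is the unique $\mathbb Q[\mathbf t^\pm]$-linear map with $\operatorname{Hilb}(\mathbf 1(C))=\prod_i(1-\mathbf t^{v_i})^{-1}$ for every smooth cone $C$ (apex at the origin) with primitive ray generators $v_i$; for a polyhedron $P$ write $\operatorname{Hilb}(P)=\operatorname{Hilb}(\mathbf 1(P))$. For $\boldsymbol\zeta\in\mathbb R^n$ and $a\in\mathbb R$, $H_{\boldsymbol\zeta=a}=\{x:\langle\boldsymbol\zeta,x\rangle=a\}$. For a Laurent polynomial (or element of $\mathcal P_n$) $f$, $f|_{H_{\boldsymbol\zeta=a}}$ is the sum of the terms $c\mathbf t^w$ of $f$ with $\langle w,\boldsymbol\zeta\rangle=a$. A polyhedron is $\boldsymbol\zeta$-pointed if it is contained in $\{x:\langle\boldsymbol\zeta,x\rangle\ge a\}$ for some $a\in\mathbb R$. $\boldsymbol\zeta$ is irrational if its coordinates are $\mathbb Q$-linearly independent. *)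

(* Defs.v *)
From HB Require Import structures.
From mathcomp Require Import all_boot all_order all_algebra.
From mathcomp Require Import finmap boolp classical_sets reals.
From mathcomp.multinomials Require Import mpoly.

Set Implicit Arguments.
Unset Strict Implicit.
Unset Printing Implicit Defensive.

Import Order.TTheory GRing.Theory Num.Theory.
Local Open Scope classical_set_scope.
Local Open Scope ring_scope.

Definition lat (R : realType) (n : nat) (z : 'rV[int]_n) : 'rV[R]_n :=
  map_mx intr z.
Arguments lat R {n} z.

Definition dot (R : realType) (n : nat) (u x : 'rV[R]_n) : R :=
  \sum_(i < n) u 0 i * x 0 i.

Definition hplane (R : realType) (n : nat) (zeta : 'rV[R]_n) (a : R) :
  set 'rV[R]_n := [set x | dot zeta x = a].

Definition conv_hull (R : realType) (n : nat) (I : finType)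
    (s : I -> 'rV[int]_n) : set 'rV[R]_n :=
  [set x | exists c : I -> R, [/\ forall i, 0 <= c i, \sum_i c i = 1
                                & x = \sum_i c i *: lat R (s i)]].

Definition cone_hull (R : realType) (n : nat) (I : finType)
    (v : I -> 'rV[int]_n) : set 'rV[R]_n :=
  [set x | exists c : I -> R, (forall i, 0 <= c i) /\
                              x = \sum_i c i *: lat R (v i)].

Arguments conv_hull R {n I} s.
Arguments cone_hull R {n I} v.

(* Lattice polytope + rational polyhedral cone; k = 0 gives the empty set.
   Lower-dimensional polyhedra and polyhedra containing lines are included. *)
Definition lattice_polyhedron (R : realType) (n : nat) (P : set 'rV[R]_n) : Prop :=
  exists (k m : nat) (s : 'I_k -> 'rV[int]_n) (v : 'I_m -> 'rV[int]_n),
    P = [set x + y | x in conv_hull R s & y in cone_hull R v].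

Definition contains_line (R : realType) (n : nat) (P : set 'rV[R]_n) : Prop :=
  exists x d : 'rV[R]_n, d != 0 /\ forall t : R, P (x + t *: d).

(* Not required to be full-dimensional: C may be the single point w. *)
Definition pointed_rational_cone (R : realType) (n : nat) (w : 'rV[int]_n)
    (C : set 'rV[R]_n) : Prop :=
  ~ contains_line C /\
  exists (m : nat) (v : 'I_m -> 'rV[int]_n),
    C = [set lat R w + y | y in cone_hull R v].

(* v is part of a Z-basis (the rows of a matrix invertible over Z); the cone it
   generates is then smooth, with primitive ray generators v i. *)
Definition smooth_generators (n m : nat) (v : 'I_m -> 'rV[int]_n) : Prop :=
  exists (M : 'M[int]_n) (f : 'I_m -> 'I_n),
    [/\ M \in unitmx, injective f & forall i, v i = row (f i) M].

Definition zeta_pointed (R : realType) (n : nat) (zeta : 'rV[R]_n)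
    (P : set 'rV[R]_n) : Prop :=
  exists a : R, P `<=` [set x | a <= dot zeta x].

(* The face of P on which <zeta, .> is minimal, written P^{-zeta}. *)
Definition min_face (R : realType) (n : nat) (zeta : 'rV[R]_n)
    (P : set 'rV[R]_n) : set 'rV[R]_n :=
  [set x | P x /\ forall y, P y -> dot zeta x <= dot zeta y].

(* The series \sum_z f(z) t^z is the function f of its coefficients. *)
Definition series (n : nat) : Type := 'rV[int]_n -> rat.

Definition indic (R : realType) (n : nat) (P : set 'rV[R]_n) : series n :=
  fun z => if `[< P (lat R z) >] then 1 else 0.

Definition in_calP (R : realType) (n : nat) (f : series n) : Prop :=
  exists (k : nat) (c : 'I_k -> rat) (P : 'I_k -> set 'rV[R]_n),
    (forall i, lattice_polyhedron (P i)) /\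
    forall z, f z = \sum_(i < k) c i * indic (P i) z.

(* Finitely supported functions w |-> p w, standing for \sum_w p(w) t^w. *)
Definition laurent (n : nat) : Type := {fsfun 'rV[int]_n -> rat with 0}.

Definition laurent_act (n : nat) (p : laurent n) (f : series n) : series n :=
  fun z => \sum_(w <- finsupp p) p w * f (z - w).

Definition ratfun (n : nat) : fieldType := {fraction {mpoly rat[n]}}.

Definition ratfun_const (n : nat) (a : rat) : ratfun n :=
  tofrac (a%:MP : {mpoly rat[n]}).

Definition tmon (n : nat) (w : 'rV[int]_n) : ratfun n :=
  \prod_(i < n) (tofrac ('X_i : {mpoly rat[n]}) : ratfun n) ^ (w 0 i).

Definition laurent_ratfun (n : nat) (p : laurent n) : ratfun n :=
  \sum_(w <- finsupp p) ratfun_const n (p w) * tmon w.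

Definition laurent_restr (R : realType) (n : nat) (p : laurent n)
    (zeta : 'rV[R]_n) (b : R) : laurent n :=
  [fsfun w in finsupp p => if dot zeta (lat R w) == b then p w else 0].

Arguments in_calP R {n} f.

(* Maps are total on series; only the values on calP_n are constrained. *)
Definition is_Hilb (R : realType) (n : nat) (H : series n -> ratfun n) : Prop :=
  [/\ forall f g : series n, in_calP R f -> in_calP R g ->
        H (fun z => f z + g z) = H f + H g,
      forall (p : laurent n) (f : series n), in_calP R f ->
        H (laurent_act p f) = laurent_ratfun p * H f
    & forall (m : nat) (v : 'I_m -> 'rV[int]_n), smooth_generators v ->
        H (indic (cone_hull R v)) = \prod_(i < m) (1 - tmon (v i))^-1].

(* The map determined on calP_n by is_Hilb, picked by choice. *)
Definition Hilb (R : realType) (n : nat) : series n -> ratfun n :=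
  if pselect (exists H : series n -> ratfun n, is_Hilb R H) is left e
  then projT1 (cid e) else fun=> 0.

Definition HilbP (R : realType) (n : nat) (P : set 'rV[R]_n) : ratfun n :=
  Hilb R (indic P).

(* Main.v *)
Require Import Defs.
From mathcomp Require Import all_boot all_order all_algebra.
From mathcomp Require Import finmap boolp classical_sets reals.
From mathcomp.multinomials Require Import mpoly.
From mathcomp Require Import zify ring lra.
Import Order.TTheory GRing.Theory Num.Theory.
Set Implicit Arguments.
Unset Strict Implicit.
Unset Printing Implicit Defensive.
Local Open Scope classical_set_scope.
Local Open Scope ring_scope.

(* Write D_v f = (1 - t^v) f, and call a series torsion if a product of
   operators D_v with v != 0 kills it.  By Dickson's lemma a product of such
   operators makes the series of a cone finite, so a series in calP_n with zero
   Hilbert series is torsion; in particular so is sum_l a_l 1(C_l) - phi.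
   Modulo torsion, a cone which is not zeta-pointed, with apex w, is a series
   supported in <zeta, z> > <zeta, w>, because cones are invariant under
   suitable maps z |-> k z + u.  After this replacement the series
   sum_l a_l 1(C_l) - phi has support bounded below along zeta, hence it is
   killed by operators D_v with <zeta, v> = 0 only.  These act on each slice
   <zeta, z> = b separately, and applying Hilb to the slice gives the formula. *)

(** * Dickson's lemma *)

Lemma minimal_value (f : nat -> nat) (N : nat) :
  exists m, (N <= m)%N /\ forall k, (N <= k)%N -> (f m <= f k)%N.
Proof.
have ex : exists d, `[< exists m, (N <= m)%N /\ f m = d >].
  by exists (f N); apply/asboolP; exists N.
case: (ex_minnP ex) => d /asboolP[m [Nm <-]] dmin.
by exists m; split=> // k Nk; apply: dmin; apply/asboolP; exists k.
Qed.

(** Each index is chosen to minimize f among those after the previous one, and every later index is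
    a competitor for that minimum. *)
Lemma nondecreasing_subsequence (f : nat -> nat) :
  exists phi : nat -> nat, {homo phi : i j / (i < j)%N} /\
    {homo f \o phi : i j / (i <= j)%N}.
Proof.
have /choice[g gP] := minimal_value f.
pose phi := fix phi k := if k is k'.+1 then g (phi k').+1 else g 0.
have phiS k : (phi k < phi k.+1)%N by have [] := gP (phi k).+1.
exists phi; split; first exact: homo_ltn ltn_trans phiS.
apply: homo_leq leqnn leq_trans _ => -[|k] /=.
  by have [_] := gP 0; apply.
have [le_phi min_phi] := gP (phi k).+1.
by apply: min_phi; apply: leq_trans (ltnW (phiS k.+1)).
Qed.

Lemma common_nondecreasing_subsequence (T : finType) (f : nat -> T -> nat) :
  exists phi : nat -> nat, {homo phi : i j / (i < j)%N} /\
    forall t, {homo (fun k => f (phi k) t) : i j / (i <= j)%N}.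
Proof.
have [phi [incr mono]] : exists phi : nat -> nat,
    {homo phi : i j / (i < j)%N} /\
    forall t, t \in enum T -> {homo (fun k => f (phi k) t) : i j / (i <= j)%N}.
  elim: (enum T) => [|t s [phi [incr mono]]]; first by exists id; split.
  have [psi [incr' mono']] := nondecreasing_subsequence (fun k => f (phi k) t).
  exists (phi \o psi); split=> [i j ij | u]; first exact/incr/incr'.
  rewrite inE => /predU1P[->|us] i j ij; first exact: mono'.
  apply: (mono u us); move: ij; rewrite leq_eqVlt => /predU1P[->//|ij].
  exact/ltnW/incr'.
by exists phi; split=> // t; apply: mono; rewrite mem_enum.
Qed.

(** A bounded integer t is recorded by the two naturals B + t and B - t; along a subsequence on
    which both are nondecreasing, t is constant. *)
Lemma bounded_dickson (S T : finType) (d : nat -> S -> nat)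
    (t : nat -> T -> int) (B : T -> int) :
  (forall k x, `|t k x| <= B x) ->
  exists i j, [/\ (i < j)%N, forall x, t i x = t j x
                & forall x, (d i x <= d j x)%N].
Proof.
move=> tB.
pose f k (x : S + (T * bool)) : nat := match x with
  | inl y => d k y
  | inr (y, e) => absz (B y + (-1) ^+ e * t k y)
  end.
have [phi [incr mono]] := common_nondecreasing_subsequence f.
exists (phi 0), (phi 1); split; first exact: incr.
  move=> x; have := mono (inr (x, true)) 0 1 isT; have := mono (inr (x, false)) 0 1 isT.
  rewrite /f /=; have := tB (phi 0) x; have := tB (phi 1) x.
  move: (t _ x) (t _ x) (B x) => a b c; rewrite expr0 expr1 !ler_norml mul1r mulN1r.
  move=> /andP[? ?] /andP[? ?]; lia.
by move=> x; apply: (mono (inl x) 0 1).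
Qed.

(** * Difference operators on series *)

Section Differences.
Variable n : nat.
Local Notation Z := 'rV[int]_n.
Implicit Types (f g h : series n) (u v z : Z) (V W : seq Z).

Definition diff v f : series n := fun z => f z - f (z - v).
Definition diffs V f : series n := foldr diff f V.

Definition finite_support f := exists s : seq Z, forall z, f z != 0 -> z \in s.

Lemma diffC u v f : diff u (diff v f) = diff v (diff u f).
Proof. by apply/funext => z; rewrite /diff (addrAC z); ring. Qed.

Lemma diffs_diff V v f : diffs V (diff v f) = diff v (diffs V f).
Proof. by elim: V => //= u V ->; rewrite diffC. Qed.

Lemma diffs_cat V W f : diffs (V ++ W) f = diffs V (diffs W f).
Proof. exact: foldr_cat. Qed.

Lemma diffs_catC V W f : diffs (V ++ W) f = diffs (W ++ V) f.
Proof.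
rewrite !diffs_cat; elim: V => //= v V ->.
by rewrite diffs_diff.
Qed.

Lemma diffs_perm V W f : perm_eq V W -> diffs V f = diffs W f.
Proof.
move=> pVW; apply: (@catCA_perm_ind _ (fun X => diffs V f = diffs X f)) pVW _ => //.
by move=> s1 s2 s3 ->; rewrite !catA !(diffs_cat (_ ++ _)) diffs_catC.
Qed.

Lemma diffs0 V : diffs V (fun=> 0) = fun=> 0.
Proof. by elim: V => //= v V ->; apply/funext => z; rewrite /diff subrr. Qed.

Lemma diffs_comb V (I : Type) (r : seq I) (P : pred I) (c : I -> rat)
    (F : I -> series n) :
  diffs V (fun z => \sum_(i <- r | P i) c i * F i z) =
  fun z => \sum_(i <- r | P i) c i * diffs V (F i) z.
Proof.
elim: V => //= v V ->; apply/funext => z.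
by rewrite /diff -sumrB; apply: eq_bigr => i _; rewrite mulrBr.
Qed.

Lemma diffsB V f g : diffs V (fun z => f z - g z) =
  fun z => diffs V f z - diffs V g z.
Proof.
by elim: V => //= v V ->; apply/funext => z; rewrite /diff; ring.
Qed.

Lemma diffs_shift V u f : diffs V (fun z => f (z - u)) =
  fun z => diffs V f (z - u).
Proof.
by elim: V => //= v V ->; apply/funext => z; rewrite /diff (addrAC z).
Qed.

(** Applied to predicates of <zeta, z> and to V orthogonal to zeta: half-spaces and slices can then
    be cut out of a series without leaving the kernel of the operators. *)
Lemma diffs_restrict V (P : pred Z) f :
  (forall v z, v \in V -> P (z - v) = P z) ->
  diffs V (fun z => if P z then f z else 0) =
  fun z => if P z then diffs V f z else 0.
Proof.
elim: V => //= v V IH PV; rewrite IH; last first.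
  by move=> u z uV; apply: PV; rewrite inE uV orbT.
apply/funext => z; rewrite /diff PV ?mem_head//.
by case: (P z); rewrite ?subrr.
Qed.

Lemma diffs_subset V (p : pred Z) f : diffs (filter p V) f = (fun=> 0) ->
  diffs V f = fun=> 0.
Proof.
move=> V0; have /permPl/(diffs_perm f)<- := perm_filterC p V.
by rewrite diffs_catC diffs_cat V0 diffs0.
Qed.

Lemma finite_supportB f g : finite_support f -> finite_support g ->
  finite_support (fun z => f z - g z).
Proof.
move=> [s sf] [t tg]; exists (s ++ t) => z nz.
rewrite mem_cat; case: (eqVneq (f z) 0) => [f0|/sf->//].
by rewrite tg ?orbT//; apply: contra_neq nz => ->; rewrite f0 subrr.
Qed.

Lemma finite_support_shift v f : finite_support f ->
  finite_support (fun z => f (z - v)).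
Proof.
move=> [s sf]; exists [seq x + v | x <- s] => z /sf zs.
by apply/mapP; exists (z - v); rewrite ?subrK.
Qed.

Lemma finite_support_comb (I : Type) (r : seq I) (P : pred I) (c : I -> rat)
    (F : I -> series n) :
  (forall i, P i -> finite_support (F i)) ->
  finite_support (fun z => \sum_(i <- r | P i) c i * F i z).
Proof.
move=> finF; elim: r => [|i r [s sP]].
  by exists [::] => z; rewrite big_nil eqxx.
case: (boolP (P i)) => Pi; last by exists s => z; rewrite big_cons (negPf Pi) => /sP.
have [t tP] := finF i Pi; exists (t ++ s) => z.
rewrite big_cons Pi mem_cat => nz.
case: (eqVneq (F i z) 0) => [f0|/tP->//].
by rewrite sP ?orbT//; apply: contra_neq nz => ->; rewrite f0 mulr0 addr0.
Qed.

(** * Finiteness of iterated differences of stable sets *)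

Definition indicZ (A : set Z) : series n := fun z => if `[< A z >] then 1 else 0.

(** If no list exhausted A, picking each point outside the list of its predecessors would give a
    sequence in A without repetitions. *)
Lemma antichain_finite (A : set Z) :
  (forall s : nat -> Z, (forall k, A (s k)) ->
     exists i j, (i < j)%N /\ s i = s j) ->
  exists s : seq Z, forall z, A z -> z \in s.
Proof.
move=> rep; apply: contrapT => noseq.
have /choice[x xP] : forall s : seq Z, exists z, A z /\ z \notin s.
  move=> s; apply: contrapT => nox; apply: noseq; exists s => z Az.
  by apply: contrapT => /negP zs; apply: nox; exists z.
pose pre := fix pre k := if k is k'.+1 then x (pre k') :: pre k' else [::].
have preP i j : (i < j)%N -> x (pre i) \in pre j.
  elim: j => // j IH; rewrite ltnS leq_eqVlt inE => /predU1P[->|/IH->].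
    by rewrite eqxx.
  by rewrite orbT.
have [|i [j [ij eqx]]] := rep (x \o pre); first by move=> k; have [] := xP (pre k).
by have [_] := xP (pre j); rewrite -[x (pre j)]eqx /= (preP _ _ ij).
Qed.

Definition stable V (A : set Z) := forall v z, v \in V -> A z -> A (z + v).

(* (1 - t^v) times the series of A \ B is the series of the cokernel of
   multiplication by t^v minus t^v times the series of its kernel; both are
   again differences of stable sets, now annihilated by v. *)
Lemma finite_diffs_kill (A B : set Z) (V W : seq Z) :
  B `<=` A -> stable (V ++ W) A -> stable (V ++ W) B ->
  (forall v z, v \in W -> A z -> B (z + v)) ->
  (forall A' B' : set Z, A' `<=` A -> B' `<=` A' -> stable (V ++ W) B' ->
     (forall v z, v \in V ++ W -> A' z -> B' (z + v)) ->
     exists s : seq Z, forall z, A' z -> ~ B' z -> z \in s) ->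
  finite_support (diffs V (indicZ (A `\` B))).
Proof.
elim: V A B W => [|v V IH] A B W BA stA stB kill fin.
  have [//|//|s sP] := fin A B _ BA stB.
  exists s => z /=; rewrite /indicZ; case: asboolP => [[Az nBz] _|]; last by rewrite eqxx.
  exact: sP.
have mem_cons x : (x \in V ++ v :: W) = (x \in (v :: V) ++ W).
  by rewrite !(mem_cat, inE) orbCA orbA.
have vin : v \in (v :: V) ++ W by rewrite mem_head.
rewrite /= -diffs_diff.
(* The cokernel of t^v has basis A minus [B1], its kernel has basis [A2] minus B. *)
pose B1 : set Z := [set z | B z \/ A (z - v)] `&` A.
pose A2 : set Z := [set z | A z /\ B (z + v)].
have -> : diff v (indicZ (A `\` B)) =
    fun z => indicZ (A `\` B1) z - indicZ (A2 `\` B) (z - v).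
  apply/funext => z; rewrite /diff /indicZ /B1 /A2 /setD /setI /= subrK.
  have [Azv|nAzv] := pselect (A (z - v)); have [Bz|nBz] := pselect (B z);
  have [Bzv|nBzv] := pselect (B (z - v)); have [Az|nAz] := pselect (A z);
  do ?[case: asboolP => ?]; rewrite ?subr0 ?subrr//; try by [tauto];
  try (by have := stA _ _ vin Azv; rewrite subrK);
  try (by have := stB _ _ vin Bzv; rewrite subrK);
  try (by have := BA _ Bzv); try (by have := BA _ Bz).
have stP X : stable ((v :: V) ++ W) X -> stable (V ++ v :: W) X.
  by move=> st x z; rewrite mem_cons; apply: st.
have fin' X : X `<=` A -> forall A' B' : set Z, A' `<=` X -> B' `<=` A' ->
    stable (V ++ v :: W) B' ->
    (forall x z, x \in V ++ v :: W -> A' z -> B' (z + x)) ->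
    exists s : seq Z, forall z, A' z -> ~ B' z -> z \in s.
  move=> XA A' B' A'X B'A' st' kill'; apply: fin => //.
  - by move=> z /A'X /XA.
  - by move=> x z; rewrite -mem_cons; apply: st'.
  - by move=> x z; rewrite -mem_cons; apply: kill'.
rewrite diffsB diffs_shift; apply: finite_supportB.
  apply: (IH _ _ (v :: W)).
  - by move=> z [].
  - exact: stP.
  - apply: stP => x z xV [[Bz|Azv] Az]; (split; last exact: stA); [left|right].
      exact: stB.
    by rewrite addrAC; apply: stA.
  - move=> x z xW Az; split; last by apply: stA=> //; rewrite -mem_cons mem_cat xW orbT.
    move: xW; rewrite inE => /predU1P[->|xW]; first by right; rewrite addrK.
    by left; apply: kill.
  - exact: fin'.
apply: finite_support_shift; apply: (IH _ _ (v :: W)).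
- by move=> z Bz; split; [exact: BA|exact: stB].
- by apply: stP => x z xV [Az Bzv]; split; [exact: stA|rewrite addrAC; exact: stB].
- exact: stP.
- move=> x z; rewrite inE => /predU1P[-> [] //|xW [Az _]]; exact: kill.
- by apply: fin' => z [].
Qed.

Definition multisum (m : nat) (v : 'I_m -> Z) (c : 'I_m -> nat) : Z :=
  \sum_i v i *+ c i.

(** The condition that A is well-quasi-ordered by divisibility, where x divides y when y - x is an
    N-combination of the v_i. *)
Definition wqo_cone (m : nat) (v : 'I_m -> Z) (A : set Z) :=
  forall s : nat -> Z, (forall k, A (s k)) ->
    exists i j, (i < j)%N /\ exists c, s j = s i + multisum v c.

(** Zero generators are dropped because 1 - t^0 = 0 would annihilate every series and could not be
    cancelled from a Hilbert series. *)
Definition nonzero_gens (m : nat) (v : 'I_m -> Z) : seq Z :=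
  [seq x <- codom v | x != 0].

Lemma multisum_ind (m : nat) (v : 'I_m -> Z) (Q : set Z) c z :
  (forall i x, Q x -> Q (x + v i)) -> Q z -> Q (z + multisum v c).
Proof.
move=> Qv Qz; rewrite /multisum; elim: (index_enum _) => [|i r IH].
  by rewrite big_nil addr0.
rewrite big_cons addrCA addrC; elim: (c i) => [|k IHk]; first by rewrite addr0.
by rewrite mulrSr addrA; apply: Qv.
Qed.

(** Once every nonzero generator sends A' into B', adding generators to a point of A' either leaves
    it in place or lands in B'. The well-quasi-order then forces a repetition in every sequence of
    points outside B'. *)
Lemma finite_diffs (m : nat) (v : 'I_m -> Z) (A : set Z) :
  (forall i z, A z -> A (z + v i)) -> wqo_cone v A ->
  finite_support (diffs (nonzero_gens v) (indicZ A)).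
Proof.
move=> stA wqoA; rewrite -[A]setD0.
have inV x : x \in nonzero_gens v -> exists i, x = v i.
  by rewrite mem_filter => /andP[_ /codomP].
apply: (@finite_diffs_kill _ _ _ [::]) => //.
  by move=> x z; rewrite cats0 => /inV[i ->]; apply: stA.
rewrite cats0 => A' B' A'A B'A' stB' kill.
have [|s sP] := @antichain_finite (A' `\` B'); last first.
  by exists s => z A'z nB'z; apply: sP.
move=> s sA; have [k|i [j [ij [c sj]]]] := wqoA s; first by have [/A'A] := sA k.
exists i, j; split=> //.
pose Q : set Z := [set z | z = s i \/ B' z].
have : Q (s j).
  rewrite sj; apply: multisum_ind; last by left.
  move=> l x [->|Bx]; (have [->|nz] := eqVneq (v l) 0;
    first by rewrite addr0; [left + right]).
    right; apply: kill; last by have [] := sA i.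
    by rewrite mem_filter nz codom_f.
  by right; apply: stB' => //; rewrite mem_filter nz codom_f.
by case=> [->//|]; have [_ /[apply]] := sA j.
Qed.
End Differences.

(** * Lattice points of rational cones *)

Section LatticeCones.
Variables (R : realType) (n : nat).
Local Notation Z := 'rV[int]_n.

Lemma latD (x y : Z) : lat R (x + y) = lat R x + lat R y.
Proof. exact: map_mxD. Qed.

Lemma latB (x y : Z) : lat R (x - y) = lat R x - lat R y.
Proof. exact: map_mxB. Qed.

Lemma latMn (x : Z) k : lat R (x *+ k) = k%:R *: lat R x.
Proof.
elim: k => [|k IH]; first by rewrite scale0r mulr0n /lat map_mx0.
by rewrite mulrSr latD IH -natr1 scalerDl scale1r.
Qed.

Lemma lat_inj : injective (lat R (n := n)).
Proof.
move=> x y /matrixP E; apply/rowP => j.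
by have := E 0 j; rewrite !mxE => /intr_inj.
Qed.

Lemma lat_multisum (m : nat) (v : 'I_m -> Z) c :
  lat R (multisum v c) = \sum_i (c i)%:R *: lat R (v i).
Proof.
rewrite /multisum; elim/big_rec2: _ => [|i x y _ <-]; first exact: map_mx0.
by rewrite latD latMn.
Qed.

Lemma dotDr (u x y : 'rV[R]_n) : dot u (x + y) = dot u x + dot u y.
Proof. by rewrite /dot -big_split; apply: eq_bigr => i _; rewrite mxE mulrDr. Qed.

Lemma dotZr (u x : 'rV[R]_n) a : dot u (a *: x) = a * dot u x.
Proof. by rewrite /dot mulr_sumr; apply: eq_bigr => i _; rewrite mxE mulrCA. Qed.

Lemma dot0r (u : 'rV[R]_n) : dot u 0 = 0.
Proof. by rewrite -(scale0r 0) dotZr mul0r. Qed.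

Lemma dotBr (u x y : 'rV[R]_n) : dot u (x - y) = dot u x - dot u y.
Proof. by rewrite -scaleN1r dotDr dotZr mulN1r. Qed.

Lemma dot_sumr (u : 'rV[R]_n) (I : finType) (c : I -> R) (x : I -> 'rV[R]_n) :
  dot u (\sum_i c i *: x i) = \sum_i c i * dot u (x i).
Proof.
by elim/big_rec2: _ => [|i y1 y2 _ <-]; rewrite ?dot0r// dotDr dotZr.
Qed.

Section Cone.
Variables (m : nat) (v : 'I_m -> Z).
Let cone : set Z := [set z | cone_hull R v (lat R z)].

Lemma cone_hullD x y : cone_hull R v x -> cone_hull R v y -> cone_hull R v (x + y).
Proof.
move=> [c [c0 ->]] [d [d0 ->]]; exists (fun i => c i + d i).
split=> [i|]; first exact: addr_ge0.
by rewrite -big_split; apply: eq_bigr => i _; rewrite scalerDl.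
Qed.

Lemma cone_hull0 : cone_hull R v 0.
Proof.
by exists (fun=> 0); split=> //; rewrite big1 // => i _; rewrite scale0r.
Qed.

Lemma cone_hullZ a x : 0 <= a -> cone_hull R v x -> cone_hull R v (a *: x).
Proof.
move=> a0 [c [c0 ->]]; exists (fun i => a * c i).
split=> [i|]; first exact: mulr_ge0.
by rewrite scaler_sumr; apply: eq_bigr => i _; rewrite scalerA.
Qed.

Lemma cone_hull_gen i : cone_hull R v (lat R (v i)).
Proof.
exists (fun j => (j == i)%:R); split=> // .
rewrite (bigD1 i) //= eqxx scale1r big1 ?addr0 // => j /negPf->.
by rewrite scale0r.
Qed.

Lemma cone_hull_multisum c : cone_hull R v (lat R (multisum v c)).
Proof. by rewrite lat_multisum; exists (fun i => (c i)%:R). Qed.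

(** Each coefficient is divided by K with remainder. What is removed is K times an N-combination, so
    the reduction of K z + u can be carried out on z itself. *)
Lemma cone_reduce K z : (0 < K)%N -> cone z -> exists q c,
  (forall i, 0 <= c i <= K%:R) /\
  lat R (z - multisum v q *+ K) = \sum_i c i *: lat R (v i).
Proof.
move=> K0 [c [c0 zE]]; have K0' : 0 < K%:R :> R by rewrite ltr0n.
pose q i := Num.truncn (c i / K%:R).
exists q, (fun i => c i - (q i)%:R * K%:R); split=> [i|].
  have /andP[] := truncn_itv (divr_ge0 (c0 i) (ltW K0')).
  rewrite -/(q i) ler_pdivlMr // ltr_pdivrMr // -natr1 mulrDl mul1r => h1 h2.
  by rewrite subr_ge0 h1 lerBlDl ltW.
rewrite latB latMn lat_multisum zE scaler_sumr -sumrB; apply: eq_bigr => i _.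
by rewrite scalerBl scalerA mulrC.
Qed.

Lemma combination_bound (K : nat) (c : 'I_m -> R) (z : Z) :
  (forall i, 0 <= c i <= K%:R) -> lat R z = \sum_i c i *: lat R (v i) ->
  forall j, `|z 0 j| <= (\sum_i `|v i 0 j|) *+ K.
Proof.
move=> cK zE j; rewrite -(ler_int R).
have -> : (`|z 0 j|%:~R : R) = `|lat R z 0 j| by rewrite mxE intr_norm.
rewrite zE summxE (le_trans (ler_norm_sum _ _ _)) // -mulr_natl.
rewrite rmorphM rmorph_sum /= mulr_sumr; apply: ler_sum => i _.
have /andP[c0 cle] := cK i.
rewrite !mxE normrM (ger0_norm c0) -intr_norm.
by rewrite ler_wpM2r ?mulrz_nat // ler0z.
Qed.

(** As in Gordan's lemma, s_k is an N-combination plus a remainder with bounded coordinates; equal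
    remainders and nondecreasing coefficients make s_j - s_i an N-combination. The bounded sequence
    t is carried along for [cone_dilation]. *)
Lemma cone_dickson (s t : nat -> Z) (B : 'I_n -> int) :
  (forall k, cone (s k)) -> (forall k j, `|t k 0 j| <= B j) ->
  exists i j, [/\ (i < j)%N, t i = t j & exists c, s j = s i + multisum v c].
Proof.
move=> sC tB.
have /choice[d /choice[c dc]] := fun k => cone_reduce (ltn0Sn 0) (sC k).
pose r k x := match x with
  | inl j => (s k - multisum v (d k) *+ 1) 0 j
  | inr j => t k 0 j
  end.
have rB k x : `|r k x| <= match x with
    inl j => (\sum_i `|v i 0 j|) *+ 1 | inr j => B j end.
  by case: x => j /=; [case: (dc k) => [? /combination_bound]; apply | exact: tB].
have [i [j [ij rE dij]]] := bounded_dickson d rB.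
exists i, j; split=> //; first by apply/rowP => x; apply: (rE (inr x)).
exists (fun l => d j l - d i l)%N.
have eqr : s i - multisum v (d i) = s j - multisum v (d j).
  by apply/rowP => x; have := rE (inl x); rewrite /r !mulr1n.
rewrite -(subrK (multisum v (d i)) (s i)) eqr -addrA /multisum -big_split /=.
rewrite -[LHS](subrK (multisum v (d j))) /multisum; congr (_ + _).
by apply: eq_bigr => l _; rewrite -mulrnDr subnKC.
Qed.

Lemma cone_translate i z : cone z -> cone (z + v i).
Proof.
move=> zC; rewrite /cone /= latD.
by apply: cone_hullD => //; apply: cone_hull_gen.
Qed.

Lemma cone_wqo : wqo_cone v cone.
Proof.
move=> s sC; have [k j|i [j [ij _ sj]]] := @cone_dickson s (fun=> 0) (fun=> 0) sC.
  by rewrite mxE normr0.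
by exists i, j.
Qed.

Lemma cone_dilate k u z : cone u -> cone z -> cone (z *+ k + u).
Proof.
move=> uC zC; rewrite /cone /= latD latMn; apply: cone_hullD => //.
by apply: cone_hullZ.
Qed.

(* Counterexamples z_k to a dilation factor k + 1 may be reduced modulo the
   generators to bounded ones.  Dickson's lemma then yields i < j with equal
   z_i = z_j such that (j - i) z_i is in the cone. *)
Lemma cone_dilation (u : Z) :
  exists2 k, (0 < k)%N & forall z, cone (z *+ k + u) -> cone z.
Proof.
apply: contrapT => nok.
have /choice[z zP] : forall k, exists z, [/\ ~ cone z, cone (z *+ k.+1 + u)
    & forall j, `|z 0 j| <= `|u 0 j| + \sum_i `|v i 0 j|].
  move=> k; apply: contrapT => noz; apply: nok; exists k.+1 => // z zC.
  apply: contrapT => nzC.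
  have [q [c [cP yE]]] := cone_reduce (ltn0Sn k) zC.
  have yE' : z *+ k.+1 + u - multisum v q *+ k.+1 = (z - multisum v q) *+ k.+1 + u.
    by rewrite mulrnBl addrAC.
  rewrite yE' in yE.
  apply: noz; exists (z - multisum v q); split.
  - move=> zC'; apply: nzC; rewrite -(subrK (multisum v q) z) /cone /= latD.
    by apply: cone_hullD => //; apply: cone_hull_multisum.
  - by exists c; split=> // i; case/andP: (cP i).
  move=> j; have := combination_bound cP yE j.
  move: (z - multisum v q) => x; rewrite mxE mulmxnE => xB.
  (* With K = k + 1 and S the sum of the |v_i j|, the bound K S on K x + u gives K |x_j| <= K S +
     |u_j|, hence a bound on |x_j| independent of k. *)
  rewrite -(ler_pMn2r (ltn0Sn k)) -normrMn -[x 0 j *+ _](addrK (u 0 j)) mulrnDl.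
  rewrite (le_trans (ler_normB _ _)) // addrC lerD // mulrS lerDl mulrn_wge0 //.
have [] := @cone_dickson (fun k => z k *+ k.+1 + u) z
  (fun j => `|u 0 j| + \sum_i `|v i 0 j|).
- by move=> k; have [] := zP k.
- by move=> k; have [] := zP k.
move=> i [j [ij zij [c yij]]]; have [nz _ _] := zP i; apply: nz.
have E : z i *+ (j - i) = multisum v c.
  rewrite -subSS mulrnBr ?ltnS ?(ltnW ij) //.
  by move: yij; rewrite /= -zij addrAC => /addIr->; rewrite addrAC subrr add0r.
have ji0 : (j - i)%:R != 0 :> R by rewrite pnatr_eq0 subn_eq0 -ltnNge.
have -> : cone (z i) = cone_hull R v ((j - i)%:R^-1 *: lat R (multisum v c)).
  by rewrite -E latMn scalerA mulVf // scale1r.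
by apply: cone_hullZ; [rewrite invr_ge0|exact: cone_hull_multisum].
Qed.

Lemma cone_hull_comb (I : finType) (c : I -> R) (x : I -> 'rV[R]_n) :
  (forall i, 0 <= c i) -> (forall i, cone_hull R v (x i)) ->
  cone_hull R v (\sum_i c i *: x i).
Proof.
move=> c0 xC; elim/big_ind: _; [exact: cone_hull0|exact: cone_hullD|].
by move=> i _; apply: cone_hullZ.
Qed.

Lemma dot_cone_ge0 zeta x : (forall i, 0 <= dot zeta (lat R (v i))) ->
  cone_hull R v x -> 0 <= dot zeta x.
Proof.
move=> v0 [c [c0 ->]]; rewrite dot_sumr sumr_ge0 // => i _.
by rewrite mulr_ge0.
Qed.

(* The lattice points of a slice form F + N{v_i : <zeta, v_i> = 0} with F
   finite, so the slice and conv(F) + cone{v_i : <zeta, v_i> = 0} have the same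
   lattice points; the slice itself need not be a lattice polyhedron. *)
Lemma slice_lattice_polyhedron (w : Z) zeta b :
  (forall i, 0 <= dot zeta (lat R (v i))) ->
  exists Q, lattice_polyhedron Q /\ forall z, Q (lat R z) <->
    ([set lat R w + y | y in cone_hull R v] `&` hplane zeta b) (lat R z).
Proof.
move=> v0.
(* Generators of positive height become 0 rather than being removed, which keeps the index type
   ['I_m]. *)
pose v' i : Z := if dot zeta (lat R (v i)) == 0 then v i else 0.
pose d := b - dot zeta (lat R w).
(* In the slice, a generator of positive height has coefficient at most d / <zeta, v_i>; generators
   of height 0 keep only a fractional part, at most 1. K bounds both. *)
pose K := (\max_i Num.truncn (d / dot zeta (lat R (v i)))).+1.
(* N bounds the coordinates of the remainders, which thus lie in the box [-N, N]^n, encoded as a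
   finite type by shifting ['I_(N + N).+1] by N. *)
pose N := (\sum_j absz ((\sum_i `|v i 0 j|) *+ K))%N.
pose toz (x : 'rV['I_(N + N).+1]_n) : Z := \row_j ((x 0 j : nat)%:Z - N%:Z).
pose E := [pred x | `[< dot zeta (lat R (w + toz x)) = b /\ cone (toz x) >]].
pose s (i : 'I_#|E|) := w + toz (enum_val i).
have sE i : dot zeta (lat R (s i)) = b /\ cone (toz (enum_val i)).
  exact/asboolP/(enum_valP i).
exists [set x + y | x in conv_hull R s & y in cone_hull R v']; split.
  by exists #|E|, m, s, v'.
move=> z; split=> [[_ [c [c0 c1 ->]] [_ [e [e0 ->]]] zE] | [[_ [c [c0 ->]] zE] zb]].
  split; last first.
    rewrite /hplane /= -zE dotDr !dot_sumr [X in _ + X]big1 ?addr0.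
      under eq_bigr do rewrite (proj1 (sE _)).
      by rewrite -mulr_suml c1 mul1r.
    move=> i _; rewrite /v'; case: eqP => [->|_]; first by rewrite mulr0.
    by rewrite /lat map_mx0 dot0r mulr0.
  exists (\sum_i c i *: lat R (toz (enum_val i)) + \sum_i e i *: lat R (v' i)).
    apply: cone_hullD; apply: cone_hull_comb => // i; first by have [] := sE i.
    rewrite /v'; case: eqP => _; first exact: cone_hull_gen.
    by rewrite /lat map_mx0; apply: cone_hull0.
  rewrite -zE addrA; congr (_ + _).
  under [RHS]eq_bigr do rewrite latD scalerDr.
  by rewrite big_split /= -scaler_suml c1 scale1r.
have dE : d = \sum_i c i * dot zeta (lat R (v i)).
  by rewrite -dot_sumr /d -zb -zE dotDr addrAC subrr add0r.
pose q i := if dot zeta (lat R (v i)) == 0 then Num.truncn (c i) else 0%N.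
pose r := z - w - multisum v q.
have rE : lat R r = \sum_i (c i - (q i)%:R) *: lat R (v i).
  rewrite /r !latB -zE [lat R w + _]addrC addrK lat_multisum -sumrB.
  by apply: eq_bigr => i _; rewrite scalerBl.
have cK i : 0 <= c i - (q i)%:R <= K%:R.
  rewrite /q; case: eqP => [_|/eqP nz].
    have /andP[h1] := truncn_itv (c0 i); rewrite -natr1 => h2.
    rewrite subr_ge0 h1 lerBlDl (le_trans (ltW h2)) // lerD2l ler1n //.
  rewrite subr0 c0 /=.
  have zv : 0 < dot zeta (lat R (v i)) by rewrite lt_def nz v0.
  apply: (@le_trans _ _ (d / dot zeta (lat R (v i)))).
    rewrite ler_pdivlMr // dE (bigD1 i) //= lerDl sumr_ge0 // => j _.
    by rewrite mulr_ge0.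
  have := truncnS_gt (d / dot zeta (lat R (v i))) => /ltW/le_trans; apply.
  by rewrite ler_nat ltnS; apply: (leq_bigmax i).
have rB j : `|r 0 j| <= N%:Z.
  apply: le_trans (combination_bound cK rE j) _.
  rewrite /N (bigD1 j) //= PoszD -[leLHS]addr0 lerD // gez0_abs //.
  by rewrite mulrn_wge0 // sumr_ge0.
have [x xr] : exists x, toz x = r.
  pose y j := r 0 j; exists (\row_j inord (absz (y j + N%:Z))).
  apply/rowP => j; have := rB j; rewrite -[RHS]/(y j) -/(y j) !mxE; move: (y j) => {}y.
  by rewrite ler_norml => /andP[y1 y2]; rewrite inordK; lia.
have q0 : dot zeta (lat R (multisum v q)) = 0.
  rewrite lat_multisum dot_sumr big1 // => i _; rewrite /q.
  by case: eqP => [->|_]; rewrite ?mulr0 ?mul0r.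
have zr : z = w + r + multisum v q.
  by rewrite /r -addrA subrK addrC subrK.
have xE : x \in E.
  apply/asboolP; rewrite xr; split.
    by move: zb; rewrite /hplane /= zr latD dotDr q0 addr0.
  by exists (fun i => c i - (q i)%:R); split=> // i; case/andP: (cK i).
exists (lat R (w + r)).
  exists (fun i => (i == enum_rank_in xE x)%:R); split=> //.
    by rewrite (bigD1 (enum_rank_in xE x)) //= eqxx big1 ?addr0 // => i /negPf->.
  rewrite (bigD1 (enum_rank_in xE x)) //= eqxx scale1r big1 ?addr0.
    by rewrite /s enum_rankK_in // xr.
  by move=> i /negPf->; rewrite scale0r.
exists (lat R (multisum v q)); last by rewrite -latD -zr.
rewrite lat_multisum; exists (fun i => (q i)%:R); split=> //.
apply: eq_bigr => i _; rewrite /q /v'; case: eqP => // _.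
by rewrite !scale0r.
Qed.
End Cone.
End LatticeCones.

(** * Replacing cones which are not zeta-pointed *)

Section Flip.
Variables (R : realType) (n : nat).
Local Notation Z := 'rV[int]_n.
Implicit Types (f g h e : series n) (v u z : Z) (V : seq Z) (zeta : 'rV[R]_n).

Definition vanishes_below zeta (M : R) f :=
  forall z, dot zeta (lat R z) < M -> f z = 0.

Lemma vanishes_below_diffs zeta M V f : vanishes_below zeta M f ->
  exists M', vanishes_below zeta M' (diffs V f).
Proof.
move=> f0; elim: V => [|v V [N IH]]; first by exists M.
exists (Num.min N (N + dot zeta (lat R v))) => z.
rewrite lt_min => /andP[z1 z2].
by rewrite /= /diff !IH ?subrr// latB dotBr ltrBlDr.
Qed.

Lemma finite_support_vanishes_below zeta f : finite_support f ->
  exists M, vanishes_below zeta M f.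
Proof.
move=> [s sf]; have [M MP] : exists M, forall z, z \in s -> M <= dot zeta (lat R z).
  elim: s {sf} => [|x s [M MP]]; first by exists 0.
  exists (Num.min (dot zeta (lat R x)) M) => z; rewrite inE ge_min.
  by case/predU1P => [->|/MP->]; rewrite ?lexx ?orbT.
exists M => z; apply: contraTeq => /sf/MP; by rewrite -leNgt.
Qed.

Lemma archimedean_descent (a M x : R) : x < 0 -> exists k, a + k%:R * x < M.
Proof.
move=> x0; exists (Num.truncn ((M - a) / x)).+1.
have := truncnS_gt ((M - a) / x); rewrite ltr_ndivrMr // => h.
by rewrite addrC -ltrBrDr.
Qed.

Lemma diff_period v f k z : diff v f = (fun=> 0) -> f (z - v *+ k) = f z.
Proof.
move=> f0; elim: k => [|k <-]; first by rewrite subr0.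
have /eqP := congr1 (@^~ (z - v *+ k)) f0.
by rewrite /diff subr_eq0 mulrSr opprD addrA => /eqP->.
Qed.

(** A series killed by D_v has period v; moving along v or -v brings any point below the level M,
    where f vanishes. *)
Lemma diff_eq0_inj zeta M v f : dot zeta (lat R v) != 0 ->
  vanishes_below zeta M f -> diff v f = (fun=> 0) -> f = fun=> 0.
Proof.
move=> vn0 f0 dv0; apply/funext => z; case: (ltgtP (dot zeta (lat R v)) 0) vn0 => // v0 _.
  have [k kM] := archimedean_descent (dot zeta (lat R z)) M v0.
  rewrite -[z](addrK (v *+ k)) diff_period //; apply: f0.
  by rewrite latD dotDr latMn dotZr.
have [|k kM] := archimedean_descent (dot zeta (lat R z)) M (x := - dot zeta (lat R v)).
  by rewrite oppr_lt0.
rewrite -(diff_period k z dv0); apply: f0.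
by rewrite latB dotBr latMn dotZr -mulrN.
Qed.

Definition level_part zeta V := [seq v <- V | dot zeta (lat R v) == 0].

(** The operators commute, so those with <zeta, v> = 0 can be applied first; the others are
    injective on series bounded below along zeta. *)
Lemma diffs_level zeta M V f : vanishes_below zeta M f ->
  diffs V f = (fun=> 0) -> diffs (level_part zeta V) f = fun=> 0.
Proof.
move=> f0; have /permPl/(diffs_perm f)<- :=
  perm_filterC (fun v => dot zeta (lat R v) == 0) V.
rewrite diffs_catC diffs_cat -/(level_part zeta V).
have := filter_all (predC (fun v => dot zeta (lat R v) == 0)) V.
have [N] := vanishes_below_diffs (level_part zeta V) f0.
move: (diffs _ f) (filter _ V) => g W g0; elim: W => //= v W IH /andP[vn0 Wn0].
have [N' gN'] := vanishes_below_diffs W g0.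
by move=> /(diff_eq0_inj vn0 gN')/(IH Wn0).
Qed.

(** The solution is the geometric series h(z) + h(z - v) + h(z - 2v) + ..., a finite sum at each z
    because z - k v eventually falls below M. *)
Lemma diff_solve_pos zeta M v h : 0 < dot zeta (lat R v) ->
  vanishes_below zeta M h -> exists2 e, vanishes_below zeta M e & diff v e = h.
Proof.
move=> v0 h0.
have hk z k : dot zeta (lat R (z - v *+ k)) =
    dot zeta (lat R z) - k%:R * dot zeta (lat R v).
  by rewrite latB dotBr latMn dotZr.
pose N z := (Num.truncn ((dot zeta (lat R z) - M) / dot zeta (lat R v))).+1.
have hN z k : (N z <= k)%N -> h (z - v *+ k) = 0.
  move=> Nk; apply: h0; rewrite hk ltrBlDr -ltrBlDl -ltr_pdivrMr //.
  by rewrite (lt_le_trans (truncnS_gt _)) // ler_nat.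
have tail z K : (N z <= K)%N ->
    \sum_(0 <= k < K) h (z - v *+ k) = \sum_(0 <= k < N z) h (z - v *+ k).
  move=> NK; rewrite (big_cat_nat (leq0n _) NK) //= [X in _ + X]big1_seq ?addr0 //.
  by move=> k; rewrite mem_index_iota => /andP[_ /andP[/hN]].
exists (fun z => \sum_(0 <= k < N z) h (z - v *+ k)) => [z zM|].
  rewrite big1 // => k _; apply: h0; rewrite hk (le_lt_trans _ zM) // gerBl.
  by rewrite mulr_ge0 // ltW.
(* Both sums are extended past their truncations, the one at z by one more term than the one at z -
   v, so that only h(z) survives. *)
apply/funext => z; rewrite /diff -(@tail z (N z + N (z - v)%R).+1); last first.
  by rewrite ltnW // ltnS leq_addr.
rewrite big_nat_recl // subr0 -(@tail (z - v) (N z + N (z - v)%R)%N) ?leq_addl //.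
under eq_bigr do rewrite mulrS opprD addrA.
by rewrite addrK.
Qed.

(** Since 1 - t^v = -t^v (1 - t^(-v)), an equation for v becomes one for -v. *)
Lemma diff_solve_opp v h e : diff (- v) e = (fun z => - h (z + v)) -> diff v e = h.
Proof.
move=> E; apply/funext => z; have := congr1 (@^~ (z - v)) E.
by rewrite /diff /= opprK subrK => /(congr1 -%R); rewrite opprB opprK.
Qed.

Lemma dotNl (u x : 'rV[R]_n) : dot (- u) x = - dot u x.
Proof. by rewrite /dot -sumrN; apply: eq_bigr => i _; rewrite mxE mulNr. Qed.

(** The functional <v, .> is positive on v: split h into its parts on the half-spaces <v, z> >= 0
    and <v, z> < 0, and sum the first forward along v, the second backward. *)
Lemma diff_surjective v h : v != 0 -> exists e, diff v e = h.
Proof.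
move=> vn0; pose l := lat R v.
have l0 : 0 < dot l (lat R v).
  have [j vj] := rV0Pn _ vn0; rewrite /dot /l (bigD1 j) //=.
  rewrite ltr_pwDl // ?sumr_ge0 // => [|i _]; rewrite !mxE -expr2 ?sqr_ge0 //.
  by rewrite lt_def sqr_ge0 sqrf_eq0 intr_eq0 vj.
pose pos z := 0 <= dot l (lat R z).
have [|e1 _ E1] := @diff_solve_pos l 0 v (fun z => if pos z then h z else 0) l0.
  by move=> z; rewrite /pos ltNge => /negPf->.
have [||e2 _ E2] := @diff_solve_pos (- l) (dot l (lat R v)) (- v)
    (fun z => - (if pos (z + v) then 0 else h (z + v))).
- by rewrite -[- v]sub0r latB dotNl dotBr /lat map_mx0 dot0r sub0r opprK.
- move=> z; rewrite dotNl => zl; rewrite (_ : pos (z + v) = true) ?oppr0 //.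
  by rewrite /pos latD dotDr; lra.
have {}E2 := diff_solve_opp (h := fun z => if pos z then 0 else h z) E2.
exists (fun z => e1 z + e2 z); apply/funext => z.
have := congr1 (@^~ z) E1; have := congr1 (@^~ z) E2; rewrite /diff /=.
by case: (pos z) => A B; rewrite opprD addrACA A B ?addr0 ?add0r.
Qed.

Lemma diff_solve zeta M v h : v != 0 -> vanishes_below zeta M h ->
  exists e M', vanishes_below zeta M' e /\ diff v e = h.
Proof.
move=> vn0 h0; case: (ltgtP (dot zeta (lat R v)) 0) => v0.
- have [||e e0 E] := @diff_solve_pos zeta (M - dot zeta (lat R v)) (- v)
      (fun z => - h (z + v)).
  + by rewrite -[- v]sub0r latB dotBr /lat map_mx0 dot0r sub0r oppr_gt0.
  + by move=> z zM; rewrite h0 ?oppr0 // latD dotDr -ltrBrDr.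
  by exists e, (M - dot zeta (lat R v)); split=> //; apply: diff_solve_opp.
- by have [e e0 E] := diff_solve_pos v0 h0; exists e, M.
(* In the remaining case <zeta, v> = 0 any solution may be cut off below M, since the cut commutes
   with D_v. *)
have [e E] := diff_surjective h vn0.
exists (fun z => if M <= dot zeta (lat R z) then e z else 0), M; split.
  by move=> z; rewrite ltNge => /negPf->.
have /= -> := @diffs_restrict _ [:: v] (fun z => M <= dot zeta (lat R z)) e.
  by rewrite E; apply/funext => z; case: lerP => // /h0.
by move=> x z; rewrite inE => /eqP->; rewrite latB dotBr v0 subr0.
Qed.

Lemma diffs_solve zeta M V h : all (fun v => v != 0) V -> vanishes_below zeta M h ->
  exists e M', vanishes_below zeta M' e /\ diffs V e = h.
Proof.
elim: V M h => [|v V IH] M h; first by exists h, M.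
move=> /= /andP[vn0 Vn0] h0; have [e [N [e0 <-]]] := diff_solve vn0 h0.
by have [e' [N' [e'0 <-]]] := IH _ _ Vn0 e0; exists e', N'.
Qed.

(** The polynomial 1 - t^v divides 1 - t^(k v). *)
Lemma diffs_scale V f k : diffs V f = (fun=> 0) ->
  diffs [seq v *+ k | v <- V] f = fun=> 0.
Proof.
elim: V f => //= v V IH f; rewrite -diffs_diff => /IH; rewrite diffs_diff => E.
by apply/funext => z; rewrite /diff diff_period // subrr.
Qed.

(** Differencing z |-> f(k z + u) along v amounts to differencing f along k v. *)
Lemma diffs_dilate V f k u : diffs V f = (fun=> 0) ->
  diffs V (fun z => f (z *+ k + u)) = fun=> 0.
Proof.
move=> /(@diffs_scale _ _ k) E.
suff -> : diffs V (fun z => f (z *+ k + u)) =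
    fun z => diffs [seq v *+ k | v <- V] f (z *+ k + u) by rewrite E.
elim: V {E} => //= v V ->; apply/funext => z.
by rewrite /diff mulrnBl addrAC.
Qed.

Lemma nonzero_gens_neq0 (m : nat) (v : 'I_m -> Z) :
  all (fun x => x != 0) (nonzero_gens v).
Proof. exact: filter_all. Qed.

(* Modulo series killed by differences, the series of a cone C that is not
   zeta-pointed equals a series e0 with support bounded below.  C is invariant
   under z |-> kz + u for u = j v_i0 and large k, hence so is e0 modulo series
   killed by differences D_x with <zeta, x> = 0.  As <zeta, u> can be made
   arbitrarily negative, the part of e0 in {zeta <= 0} is itself killed by
   such D_x. *)
Lemma flip_cone (m : nat) (v : 'I_m -> Z) zeta i0 :
  dot zeta (lat R (v i0)) < 0 ->
  exists2 e, (forall z, dot zeta (lat R z) <= 0 -> e z = 0) &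
    diffs (nonzero_gens v)
      (fun z => indicZ [set z | cone_hull R v (lat R z)] z - e z) = fun=> 0.
Proof.
move=> v0; set cone := [set z | _]; set V := nonzero_gens v.
have fin : finite_support (diffs V (indicZ cone)).
  by apply: finite_diffs (@cone_wqo R n m v) => i z; apply: cone_translate.
have [M K0] := finite_support_vanishes_below zeta fin.
have [e [N [e0 eK]]] := diffs_solve (nonzero_gens_neq0 v) K0.
(* j is chosen with <zeta, u> < N, so that e vanishes at k z + u as soon as <zeta, z> <= 0. *)
have [j] := archimedean_descent 0 N v0; rewrite add0r => jN.
pose u := v i0 *+ j.
have uC : cone u.
  by rewrite /cone /u /= latMn; apply: cone_hullZ => //; apply: cone_hull_gen.
have [k k0 kP] := @cone_dilation R n m v u.
have dil z : indicZ cone (z *+ k + u) = indicZ cone z.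
  rewrite /indicZ; have [zC|nzC] := pselect (cone z).
    by rewrite !asboolT //; apply: cone_dilate.
  by rewrite !asboolF // => /kP.
have tors : diffs V (fun z => indicZ cone z - e z) = fun=> 0.
  by rewrite diffsB eK; apply/funext => z; rewrite subrr.
have lvl z : dot zeta (lat R (z *+ k + u)) =
    k%:R * dot zeta (lat R z) + j%:R * dot zeta (lat R (v i0)).
  by rewrite latD dotDr !latMn !dotZr.
pose g z := e z - e (z *+ k + u).
have gtors : diffs V g = fun=> 0.
  have := diffs_dilate k u tors; move: tors; rewrite !diffsB => t1 t2.
  have E : (fun z => indicZ cone (z *+ k + u)) = indicZ cone by apply/funext.
  apply/funext => z; have /= := congr1 (@^~ z) t1; have /= := congr1 (@^~ z) t2.
  rewrite E => /eqP; rewrite subr_eq0 => /eqP <- /eqP; rewrite subr_eq0 => /eqP<-.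
  by rewrite subrr.
have k0' : 0 < k%:R :> R by rewrite ltr0n.
have [N' g0] : exists N', vanishes_below zeta N' g.
  exists (Num.min N ((N - j%:R * dot zeta (lat R (v i0))) / k%:R)) => z.
  rewrite lt_min => /andP[z1]; rewrite ltr_pdivlMr // mulrC => z2.
  by rewrite /g !e0 ?subrr // lvl -ltrBrDr.
have glvl := diffs_level g0 gtors.
pose low z := dot zeta (lat R z) <= 0.
exists (fun z => if low z then 0 else e z) => [z|]; first by rewrite /low => ->.
(* On [low] the series g coincides with e, so cutting e off there subtracts the low part of g. *)
have -> : (fun z => indicZ cone z - (if low z then 0 else e z)) =
    fun z => (indicZ cone z - e z) - - (if low z then g z else 0).
  apply/funext => z; case: (boolP (low z)) => lz; rewrite ?oppr0 ?subr0 //.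
  rewrite opprK /g [e (_ *+ _ + _)]e0 ?subr0 ?subrK // lvl.
  by rewrite (le_lt_trans _ jN) // gerDr mulr_ge0_le0 // ltW.
rewrite (_ : (fun z => _) = fun z => (indicZ cone z - e z) -
    (if low z then - g z else 0)); last first.
  by apply/funext => z; case: (low z); rewrite ?opprK.
rewrite diffsB tors; have -> // : diffs V (fun z => if low z then - g z else 0) = fun=> 0.
apply: (@diffs_subset _ _ (fun v => dot zeta (lat R v) == 0)).
rewrite (@diffs_restrict _ _ low (fun z => - g z)); last first.
  move=> x z; rewrite mem_filter => /andP[/eqP x0 _].
  by rewrite /low latB dotBr x0 subr0.
have -> : (fun z => - g z) = fun z => 0 - g z by apply/funext => z; rewrite sub0r.
rewrite diffsB diffs0 -/(level_part zeta V) glvl.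
by apply/funext => z; rewrite subrr; case: ifP.
Qed.
End Flip.

(** * Laurent polynomials and Hilbert series *)

Section Laurent.
Variable n : nat.
Local Notation Z := 'rV[int]_n.

Let X_neq0 (i : 'I_n) : (tofrac ('X_i : {mpoly rat[n]}) : ratfun n) != 0.
Proof. by rewrite tofrac_eq0 -msize_poly_eq0 msizeX. Qed.

Lemma tmonD (u w : Z) : tmon (u + w) = tmon u * tmon w.
Proof.
by rewrite /tmon -big_split; apply: eq_bigr => i _; rewrite mxE expfzDr ?X_neq0.
Qed.

Lemma tmon0 : tmon (0 : Z) = 1.
Proof. by rewrite /tmon big1 // => i _; rewrite mxE expr0z. Qed.

Lemma tmon_nat (w : Z) (k : 'X_{1..n}) : (forall i, w 0 i = k i) ->
  tmon w = tofrac ('X_[k] : {mpoly rat[n]}).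
Proof.
move=> wk; rewrite mpolyXE_id rmorph_prod /=; apply: eq_bigr => i _.
by rewrite wk rmorphXn.
Qed.

Lemma ratfun_const0 : ratfun_const n 0 = 0.
Proof. by rewrite /ratfun_const mpolyC0 rmorph0. Qed.

Lemma ratfun_const1 : ratfun_const n 1 = 1.
Proof. by rewrite /ratfun_const mpolyC1 rmorph1. Qed.

Lemma ratfun_constN1 : ratfun_const n (-1) = -1.
Proof. by rewrite /ratfun_const mpolyCN mpolyC1 rmorphN1. Qed.

(** Multiplying by a monomial with large exponents makes all exponents nonnegative; the coefficients
    are then read off in the polynomial ring. *)
Lemma tmon_free (s : seq Z) (c : Z -> rat) : uniq s ->
  \sum_(w <- s) ratfun_const n (c w) * tmon w = 0 -> forall w, w \in s -> c w = 0.
Proof.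
move=> s_uniq s0 w ws.
pose N := (\sum_(w <- s) \sum_i absz (w 0%R i))%N.
have wN x i : x \in s -> 0 <= x 0 i + N%:Z.
  move=> xs; rewrite /N (big_rem x) //= (bigD1 i) //= !PoszD; lia.
pose k (x : Z) : 'X_{1..n} := [multinom absz (x 0 i + N%:Z)%R | i < n].
have kE x : x \in s -> tmon (x + const_mx N%:Z) = tofrac ('X_[k x] : {mpoly rat[n]}).
  by move=> xs; apply: tmon_nat => i; rewrite mnmE !mxE gez0_abs ?wN.
have : tofrac (\sum_(x <- s) c x *: 'X_[k x] : {mpoly rat[n]}) = 0.
  have := congr1 ( *%R^~ (tmon (const_mx N%:Z))) s0; rewrite /= mul0r => <-.
  rewrite rmorph_sum mulr_suml big_seq [RHS]big_seq; apply: eq_bigr => x xs.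
  by rewrite -mulrA -tmonD kE // -mul_mpolyC rmorphM.
move/eqP; rewrite tofrac_eq0 => /eqP /(congr1 (mcoeff (k w))).
rewrite mcoeff0 raddf_sum /= (bigD1_seq w) //= mcoeffZ mcoeffX eqxx mulr1.
rewrite big_seq_cond big1 ?addr0 // => x /andP[xs xw].
rewrite mcoeffZ mcoeffX; case: eqP => [kxw|_]; last by rewrite mulr0.
case/eqP: xw; apply/rowP => i; have /= := congr1 (fun m : 'X_{1..n} => m i) kxw.
rewrite !mnmE; have := wN x i xs; have := wN w i ws.
move: (x 0 i) (w 0 i) => a b; lia.
Qed.

Lemma laurent_ratfun_inj0 (p : laurent n) : laurent_ratfun p = 0 -> p =1 (fun=> 0).
Proof.
move=> p0 w; have [wp|/fsfun_dflt->//] := boolP (w \in finsupp p).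
exact: (tmon_free (fset_uniq (finsupp p)) p0 wp).
Qed.

Lemma laurent_ratfun_eq0 (p : laurent n) : p =1 (fun=> 0) -> laurent_ratfun p = 0.
Proof.
by move=> p0; rewrite /laurent_ratfun big1 // => w _; rewrite p0 ratfun_const0 mul0r.
Qed.

Lemma tmon_neq1 (v : Z) : v != 0 -> 1 - tmon v != 0.
Proof.
move=> vn0; apply/eqP => E.
have := @tmon_free [:: 0; v] (fun w => if w == 0 then 1 else -1).
rewrite /= inE eq_sym vn0 !big_cons big_nil eqxx (negPf vn0) tmon0.
rewrite ratfun_const1 ratfun_constN1 mulr1 mulN1r addr0 => /(_ isT E 0).
by rewrite inE eqxx => /(_ isT) /eqP; rewrite oner_eq0.
Qed.

Definition monomial (c : rat) (v : Z) : laurent n := [fsfun z in [fset v]%fset => c].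

(** If c = 0 the support is empty instead of {v}, and F 0 v = 0 restores the equality. *)
Lemma monomial_sum (T : nmodType) (c : rat) (v : Z) (F : rat -> Z -> T) :
  (forall z, F 0 z = 0) ->
  \sum_(z <- finsupp (monomial c v)) F (monomial c v z) z = F c v.
Proof.
move=> F0; have -> : F c v = \sum_(z <- [fset v]%fset) F (monomial c v z) z.
  by rewrite big_seq_fset1 fsfunE inE eqxx.
by apply: big_fset_incl; [exact: finsupp_sub|move=> z _ /fsfun_dflt->].
Qed.

Lemma finite_support_laurent (f : series n) : finite_support f ->
  exists p : laurent n, f = p.
Proof.
move=> [s sf]; exists [fsfun z in [fset x in s]%fset => f z].
apply/funext => z; rewrite fsfunE inE; case: ifPn => // zs.
by apply/eqP; apply: contraNT zs => /sf.
Qed.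

Lemma laurent_finite_support (p : laurent n) : finite_support p.
Proof. by exists (finsupp p) => z; rewrite mem_finsupp. Qed.
End Laurent.

(** * The module of lattice polyhedra and Hilbert maps on it *)

Section CalP.
Variables (R : realType) (n : nat).
Local Notation Z := 'rV[int]_n.
Implicit Types (f g : series n) (P : set 'rV[R]_n).

Lemma in_calP_indic P : lattice_polyhedron P -> in_calP R (indic P).
Proof.
move=> PP; exists 1, (fun=> 1), (fun=> P); split=> // z.
by rewrite big_ord1 mul1r.
Qed.

Lemma in_calP0 : in_calP R (fun _ : Z => 0).
Proof. by exists 0, (fun=> 0), (fun=> set0); split=> [[]//|z]; rewrite big_ord0. Qed.

Lemma in_calPD f g : in_calP R f -> in_calP R g -> in_calP R (fun z => f z + g z).
Proof.
move=> [k [c [P [PP fE]]]] [k' [c' [P' [PP' gE]]]].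
exists (k + k')%N, (fun i => match split i with inl j => c j | inr j => c' j end),
  (fun i => match split i with inl j => P j | inr j => P' j end); split=> [i|z].
  by case: (split i).
rewrite big_split_ord fE gE; congr (_ + _); apply: eq_bigr => i _.
  by rewrite (unsplitK (inl _ i)).
by rewrite (unsplitK (inr _ i)).
Qed.

Lemma lattice_polyhedron_translate (u : Z) P : lattice_polyhedron P ->
  lattice_polyhedron [set x | P (x - lat R u)].
Proof.
move=> [k [m [s [v ->]]]]; exists k, m, (fun i => s i + u), v.
apply/predeqP => x /=; split.
  move=> [_ [c [c0 c1 ->]] [y yv E]].
  exists (\sum_i c i *: lat R (s i + u)); first by exists c.
  exists y => //; under eq_bigr do rewrite latD scalerDr.
  by rewrite big_split /= -scaler_suml c1 scale1r addrAC E subrK.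
move=> [_ [c [c0 c1 ->]] [y yv <-]].
exists (\sum_i c i *: lat R (s i)); first by exists c.
exists y => //; under [in RHS]eq_bigr do rewrite latD scalerDr.
by rewrite big_split /= -scaler_suml c1 scale1r addrAC addrK.
Qed.

Lemma in_calP_scale_shift (c : rat) (v : Z) f : in_calP R f ->
  in_calP R (fun z => c * f (z - v)).
Proof.
move=> [k [a [P [PP fE]]]].
exists k, (fun i => c * a i), (fun i => [set x | P i (x - lat R v)]); split=> [i|z].
  exact: lattice_polyhedron_translate.
rewrite fE mulr_sumr; apply: eq_bigr => i _.
by rewrite -mulrA /indic latB.
Qed.

Lemma in_calP_scale (c : rat) f : in_calP R f -> in_calP R (fun z => c * f z).
Proof. by move=> /(in_calP_scale_shift c 0); under eq_fun do rewrite subr0. Qed.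

Lemma in_calPB f g : in_calP R f -> in_calP R g -> in_calP R (fun z => f z - g z).
Proof.
move=> fP /(in_calP_scale (-1)) gP; under eq_fun do rewrite -mulN1r.
exact: in_calPD.
Qed.

Lemma in_calP_sum (I : Type) (r : seq I) (Q : pred I) (F : I -> series n) :
  (forall i, Q i -> in_calP R (F i)) -> in_calP R (fun z => \sum_(i <- r | Q i) F i z).
Proof.
move=> FP; elim: r => [|i r IH].
  by under eq_fun do rewrite big_nil; apply: in_calP0.
under eq_fun do rewrite big_cons.
by case: (boolP (Q i)) => Qi //; apply: in_calPD => //; apply: FP.
Qed.

Lemma in_calP_diffs (V : seq Z) f : in_calP R f -> in_calP R (diffs V f).
Proof.
move=> fP; elim: V => //= v V IH; apply: in_calPB => //.
have := in_calP_scale_shift 1 v IH; by under eq_fun do rewrite mul1r.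
Qed.

Section Hilbert.
Variable H : series n -> ratfun n.
Hypothesis HP : is_Hilb R H.

(** Scalars enter [is_Hilb] only through Laurent polynomials: scaling and translation together are
    the action of the monomial c t^v. *)
Lemma is_Hilb_scale_shift (c : rat) (v : Z) f : in_calP R f ->
  H (fun z => c * f (z - v)) = ratfun_const n c * tmon v * H f.
Proof.
move=> fP; have [_ H2 _] := HP; have := H2 (monomial c v) f fP.
rewrite /laurent_act /laurent_ratfun.
rewrite (monomial_sum _ _ (F := fun a z => ratfun_const n a * tmon z)); last first.
  by move=> z; rewrite ratfun_const0 mul0r.
move=> <-; congr H; apply/funext => z.
by rewrite (monomial_sum _ _ (F := fun a w => a * f (z - w))) // => w; rewrite mul0r.
Qed.

Lemma is_Hilb_scale (c : rat) f : in_calP R f ->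
  H (fun z => c * f z) = ratfun_const n c * H f.
Proof.
move=> /(is_Hilb_scale_shift c 0); rewrite tmon0 mulr1 => <-.
by congr H; apply/funext => z; rewrite subr0.
Qed.

Lemma is_Hilb0 : H (fun=> 0) = 0.
Proof. by have := is_Hilb_scale 0 in_calP0; rewrite ratfun_const0 !mul0r. Qed.

Lemma is_HilbB f g : in_calP R f -> in_calP R g ->
  H (fun z => f z - g z) = H f - H g.
Proof.
move=> fP gP; have [H1 _ _] := HP.
rewrite -[- H g]mulN1r -ratfun_constN1 -is_Hilb_scale // -H1 //;
  last exact: in_calP_scale.
by congr H; apply/funext => z; rewrite mulN1r.
Qed.

Lemma is_Hilb_comb (I : Type) (r : seq I) (Q : pred I) (c : I -> rat)
    (F : I -> series n) : (forall i, Q i -> in_calP R (F i)) ->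
  H (fun z => \sum_(i <- r | Q i) c i * F i z) =
  \sum_(i <- r | Q i) ratfun_const n (c i) * H (F i).
Proof.
have [H1 _ _] := HP => FP; elim: r => [|i r IH].
  by rewrite big_nil -is_Hilb0; congr H; apply/funext => z; rewrite big_nil.
rewrite big_cons; under eq_fun do rewrite big_cons.
case: (boolP (Q i)) => Qi; last exact: IH.
rewrite H1 ?IH ?is_Hilb_scale //; first exact: FP.
  by apply: in_calP_scale; apply: FP.
by apply: in_calP_sum => j Qj; apply: in_calP_scale; apply: FP.
Qed.

Lemma is_Hilb_diffs (V : seq Z) f : in_calP R f ->
  H (diffs V f) = (\prod_(v <- V) (1 - tmon v)) * H f.
Proof.
move=> fP; elim: V => [|v V IH]; first by rewrite big_nil mul1r.
have VP := in_calP_diffs V fP.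
have vP := in_calP_scale_shift 1 v VP.
rewrite big_cons -mulrA -IH mulrBl mul1r.
rewrite -[tmon v]mul1r -ratfun_const1 -is_Hilb_scale_shift // -is_HilbB //.
by congr H; apply/funext => z; rewrite mul1r.
Qed.

(** The empty family spans the smooth cone {0}, with series 1. Its Hilbert series is the empty
    product 1, which fixes H on Laurent polynomials. *)
Definition no_gens : 'I_0 -> Z := fun=> 0.

Lemma cone_hull_no_gens x : cone_hull R no_gens x <-> x = 0.
Proof.
split=> [[c [_ ->]]|->]; first by rewrite big_ord0.
exact: cone_hull0.
Qed.

Lemma lattice_polyhedron_cone m (w : Z) (v : 'I_m -> Z) :
  lattice_polyhedron [set lat R w + y | y in cone_hull R v].
Proof.
exists 1, m, (fun=> w), v; apply/predeqP => x; split.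
  move=> [y yv <-]; exists (lat R w); last by exists y.
  by exists (fun=> 1); split=> //; rewrite big_ord1 ?scale1r.
move=> [_ [c [_ c1 ->]] [y yv <-]]; exists y => //.
by rewrite big_ord1 in c1; rewrite big_ord1 c1 scale1r.
Qed.

Lemma in_calP_unit : in_calP R (indic (cone_hull R no_gens)).
Proof.
apply: in_calP_indic.
suff <- : [set lat R 0 + y | y in cone_hull R no_gens] = cone_hull R no_gens.
  exact: lattice_polyhedron_cone.
apply/predeqP => x; split=> [[y yC <-]|xC]; first by rewrite /lat map_mx0 add0r.
by exists x; rewrite // /lat map_mx0 add0r.
Qed.

Lemma laurent_act_unit (p : laurent n) : laurent_act p (indic (cone_hull R no_gens)) = p.
Proof.
apply/funext => z; rewrite /laurent_act.
have E w : indic (cone_hull R no_gens) (z - w) = (w == z)%:R.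
  rewrite /indic; case: asboolP => [/cone_hull_no_gens|nC].
    rewrite -[RHS](map_mx0 (intr : int -> R)) => /lat_inj /subr0_eq->; by rewrite eqxx.
  case: eqP => // wz; case: nC; apply/cone_hull_no_gens.
  by rewrite wz subrr /lat map_mx0.
have [zp|zp] := boolP (z \in finsupp p).
  rewrite (bigD1_seq z) ?fset_uniq //= E eqxx mulr1 big1 ?addr0 // => w /negPf wz.
  by rewrite E wz mulr0.
rewrite (fsfun_dflt zp) big_seq big1 // => w wp; rewrite E.
by case: eqP => [wz|_]; rewrite ?mulr0 //; case/negP: zp; rewrite -wz.
Qed.

Lemma in_calP_laurent (p : laurent n) : in_calP R p.
Proof.
rewrite -laurent_act_unit; apply: in_calP_sum => w _.
exact/in_calP_scale_shift/in_calP_unit.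
Qed.

Lemma is_Hilb_laurent (p : laurent n) : H p = laurent_ratfun p.
Proof.
have [_ H2 H3] := HP; rewrite -{1}laurent_act_unit H2; last exact: in_calP_unit.
rewrite H3 ?big_ord0 ?mulr1 //.
by exists 1%:M, (fun i : 'I_0 => False_rect _ (notF (ltn_ord i))); split;
  rewrite ?unitmx1 // => -[].
Qed.
End Hilbert.
End CalP.

(** * Slices *)

Section Slice.
Variables (R : realType) (n : nat) (Lambda : finType).
Local Notation Z := 'rV[int]_n.

(** Along a generator of negative height the ray from the apex is unbounded below; if there is none,
    the apex has the least height in the cone. *)
Lemma zeta_pointed_gens (zeta : 'rV[R]_n) (w : Z) m (v : 'I_m -> Z) :
  zeta_pointed zeta [set lat R w + y | y in cone_hull R v] <->
  forall i, 0 <= dot zeta (lat R (v i)).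
Proof.
split=> [[a aP] i|v0]; last first.
  exists (dot zeta (lat R w)) => _ [y yv <-] /=.
  by rewrite dotDr lerDl; apply: dot_cone_ge0 yv.
rewrite leNgt; apply/negP => vi.
have [k] := archimedean_descent (dot zeta (lat R w)) a vi.
apply/negP; rewrite -leNgt -dotZr -dotDr; apply: aP.
exists (k%:R *: lat R (v i)) => //.
by apply: cone_hullZ => //; apply: cone_hull_gen.
Qed.

Lemma indic_cone (w : Z) m (v : 'I_m -> Z) :
  indic [set lat R w + y | y in cone_hull R v] =
  fun z => indicZ [set z | cone_hull R v (lat R z)] (z - w).
Proof.
apply/funext => z; rewrite /indic /indicZ; congr (if _ then _ else _).
apply: asbool_equiv_eq; split=> /= [[y yv yz]|zv].
  by rewrite latB -yz addrAC subrr add0r.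
by exists (lat R (z - w)) => //; rewrite -latD addrC subrK.
Qed.

(** Isolates the operators of a single cone at the end of the common list, where they act first. *)
Lemma flatten_perm (I T : eqType) (r : seq I) (G : I -> seq T) i : i \in r ->
  exists W, perm_eq (flatten [seq G j | j <- r]) (W ++ G i).
Proof.
move=> ir; exists (flatten [seq G j | j <- rem i r]).
have /(perm_map G)/perm_flatten/permPl-> := perm_to_rem ir.
by rewrite /= perm_catC.
Qed.

Lemma vanishes_below_comb (zeta : 'rV[R]_n) (c : Lambda -> rat) (F : Lambda -> series n) :
  (forall l, exists M, vanishes_below zeta M (F l)) ->
  exists M, vanishes_below zeta M (fun z => \sum_l c l * F l z).
Proof.
move=> FP; elim: (index_enum _) => [|l r [M MP]].
  by exists 0 => z _; rewrite big_nil.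
have [N NP] := FP l; exists (Num.min N M) => z; rewrite lt_min => /andP[zN zM].
by rewrite big_cons NP // mulr0 add0r MP.
Qed.

Lemma slice_Hilb (H : series n -> ratfun n) (a : Lambda -> rat) (w : Lambda -> Z)
    (m : Lambda -> nat) (v : forall l, 'I_(m l) -> Z) (phi : laurent n)
    (zeta : 'rV[R]_n) (b : R) :
  let C l := [set lat R (w l) + y | y in cone_hull R (v l)] in
  is_Hilb R H ->
  \sum_l ratfun_const n (a l) * H (indic (C l)) = laurent_ratfun phi ->
  (forall l, dot zeta (lat R (w l)) < b -> zeta_pointed zeta (C l)) ->
  laurent_ratfun (laurent_restr phi zeta b) =
    \sum_(l | `[< zeta_pointed zeta (C l) >])
      ratfun_const n (a l) * H (indic (C l `&` hplane zeta b)).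
Proof.
move=> C HP phiE Cpt.
pose G l := nonzero_gens (v l).
pose V := flatten [seq G l | l <- enum Lambda].
have Vperm l : exists W, perm_eq V (W ++ G l).
  by apply: flatten_perm; rewrite mem_enum.
have V0 : all (fun x => x != 0) V.
  by apply/allP => x /flattenP[_ /mapP[l _ ->]]; exact: (allP (nonzero_gens_neq0 (v l))).
have VG0 l f : diffs (G l) f = (fun=> 0) -> diffs V f = fun=> 0.
  have [W pW] := Vperm l.
  by rewrite (diffs_perm _ pW) diffs_cat => ->; apply: diffs0.
have finV W f : finite_support f -> finite_support (diffs W f).
  move=> ff; elim: W => //= x W IH.
  by apply: finite_supportB => //; apply: finite_support_shift.
have CP l : in_calP R (indic (C l)).
  by apply: in_calP_indic; apply: lattice_polyhedron_cone.
pose f z := \sum_l a l * indic (C l) z - phi z.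
have sumP : in_calP R (fun z => \sum_l a l * indic (C l) z).
  by apply: in_calP_sum => l _; apply: in_calP_scale.
have fP : in_calP R f by apply: in_calPB => //; apply: in_calP_laurent.
have Hf0 : H f = 0.
  rewrite /f (is_HilbB HP) //; last exact: in_calP_laurent.
  by rewrite (is_Hilb_comb HP) // phiE (is_Hilb_laurent HP) subrr.
have ffin : finite_support (diffs V f).
  rewrite /f diffsB diffs_comb; apply: finite_supportB; last first.
    exact/finV/laurent_finite_support.
  apply: finite_support_comb => l _; have [W pW] := Vperm l.
  rewrite (diffs_perm _ pW) diffs_cat; apply: finV.
  rewrite indic_cone diffs_shift; apply: finite_support_shift.
  by apply: finite_diffs (@cone_wqo R n _ (v l)) => i z; apply: cone_translate.
(* [diffs V f] is a Laurent polynomial whose Hilbert series is a multiple of H f = 0, and a Laurent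
   polynomial is determined by its Hilbert series. *)
have Vf : diffs V f = fun=> 0.
  have [p pE] := finite_support_laurent ffin.
  rewrite pE; apply/funext; apply: laurent_ratfun_inj0.
  by rewrite -(is_Hilb_laurent HP) -pE (is_Hilb_diffs HP) // Hf0 mulr0.
pose pt l := `[< zeta_pointed zeta (C l) >].
(* A pointed cone is kept as it is; any other is replaced by the translate of the series from
   [flip_cone], which contributes nothing at height b. *)
have /choice[e eP] : forall l, exists e : series n, [/\
    exists M, vanishes_below zeta M e,
    diffs V (fun z => indic (C l) z - e z) = (fun=> 0) &
    forall z, dot zeta (lat R z) = b ->
      e z = if pt l then indic (C l `&` hplane zeta b) z else 0].
  move=> l; case: (boolP (pt l)) => [/asboolP/zeta_pointed_gens vl|].
    exists (indic (C l)); split.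
    - exists (dot zeta (lat R (w l))) => z zw; rewrite /indic asboolF // => -[y yC zE].
      by move: zw; rewrite -zE dotDr ltNge lerDl (dot_cone_ge0 vl yC).
    - rewrite -(diffs0 V); congr diffs; apply/funext => z; exact: subrr.
    - move=> z zb; rewrite /indic; congr (if _ then _ else _).
      by apply: asbool_equiv_eq; split=> [|[]].
  move/asboolPn => npt.
  have [i vi] : exists i, dot zeta (lat R (v l i)) < 0.
    apply: contrapT => nov; apply: npt; apply/zeta_pointed_gens => i.
    by rewrite leNgt; apply/negP => vi; apply: nov; exists i.
  have [e e0 eT] := flip_cone vi.
  (* The replacement vanishes up to and including the height of the apex, and by hypothesis that
     height is at least b. *)
  have wb : b <= dot zeta (lat R (w l)).
    by rewrite leNgt; apply/negP => /Cpt.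
  exists (fun z => e (z - w l)); split.
  - exists (dot zeta (lat R (w l))) => z zw; apply: e0.
    by rewrite latB dotBr subr_le0 ltW.
  - apply: (VG0 l); rewrite indic_cone.
    by rewrite (diffs_shift (G l) (w l)
      (fun z => indicZ [set z | cone_hull R (v l) (lat R z)] z - e z)) eT.
  - by move=> z zb; apply: e0; rewrite latB dotBr zb subr_le0.
pose g z := \sum_l a l * e l z - phi z.
have Vg : diffs V g = fun=> 0.
  have : diffs V (fun z => f z - g z) = fun=> 0.
    rewrite (_ : (fun z => _) = fun z => \sum_l a l * (indic (C l) z - e l z)).
      rewrite diffs_comb; apply/funext => z; rewrite big1 // => l _.
      by have [_ -> _] := eP l; rewrite mulr0.
    apply/funext => z; rewrite /f /g opprB addrA subrK -sumrB.
    by apply: eq_bigr => l _; rewrite mulrBr.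
  rewrite diffsB Vf => E; apply/funext => z; have /= := congr1 (@^~ z) E.
  by rewrite sub0r => /eqP; rewrite oppr_eq0 => /eqP.
have [M gM] : exists M, vanishes_below zeta M g.
  have [l|M1 g1] := @vanishes_below_comb zeta a e; first by have [] := eP l.
  have [M2 g2] := finite_support_vanishes_below zeta (laurent_finite_support phi).
  exists (Num.min M1 M2) => z; rewrite lt_min => /andP[z1 z2].
  by rewrite /g g1 // g2 // subrr.
have Lg := diffs_level gM Vg.
pose slice z := dot zeta (lat R z) == b.
pose gb z := \sum_(l | pt l) a l * indic (C l `&` hplane zeta b) z
  - laurent_restr phi zeta b z.
have gbE : gb = fun z => if slice z then g z else 0.
  apply/funext => z; rewrite /gb /g /laurent_restr fsfunE /slice.
  case: (altP eqP) => zb.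
    congr (_ - _); last by case: ifPn => // /fsfun_dflt.
    rewrite big_mkcond; apply: eq_bigr => l _.
    by have [_ _ ->//] := eP l; case: (pt l); rewrite ?mulr0.
  rewrite if_same subr0 big1 // => l _; rewrite /indic asboolF ?mulr0 // => -[_ zb'].
  by rewrite zb' eqxx in zb.
have sliceP l : pt l -> in_calP R (indic (C l `&` hplane zeta b)).
  move=> /asboolP/zeta_pointed_gens vl.
  have [Q [QP QE]] := slice_lattice_polyhedron (w l) b vl.
  rewrite (_ : indic _ = indic Q); first exact: in_calP_indic.
  apply/funext => z; rewrite /indic; congr (if _ then _ else _).
  by apply: asbool_equiv_eq; split=> /QE.
have gbsP : in_calP R (fun z => \sum_(l | pt l) a l * indic (C l `&` hplane zeta b) z).
  by apply: in_calP_sum => l /sliceP; apply: in_calP_scale.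
have gbP : in_calP R gb by apply: in_calPB => //; apply: in_calP_laurent.
have Lgb : diffs (level_part zeta V) gb = fun=> 0.
  rewrite gbE diffs_restrict ?Lg; first by apply/funext => z; case: ifP.
  move=> x z; rewrite mem_filter => /andP[/eqP x0 _].
  by rewrite /slice latB dotBr x0 subr0.
(* The factors 1 - t^v with v nonzero can be cancelled in the field of rational functions, so H gb =
   0. *)
have := is_Hilb_diffs HP (level_part zeta V) gbP.
rewrite Lgb (is_Hilb0 HP) => /esym/eqP; rewrite mulf_eq0 => /orP[|/eqP].
  rewrite prodf_seq_eq0 => /hasP[x]; rewrite mem_filter => /andP[_ /(allP V0) xn0].
  by rewrite (negPf (tmon_neq1 xn0)).
rewrite /gb (is_HilbB HP) //; last exact: in_calP_laurent.
rewrite (is_Hilb_comb HP) // (is_Hilb_laurent HP) => /eqP.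
by rewrite subr_eq0 => /eqP->.
Qed.
End Slice.

(** * The slice formula and its case of the minimal face *)

Theorem theorem4p7 (R : realType) (n : nat) (Lambda : finType)
    (a : Lambda -> rat) (w : Lambda -> 'rV[int]_n)
    (C : Lambda -> set 'rV[R]_n) (phi : laurent n)
    (zeta : 'rV[R]_n) (b : R) :
  (forall l, pointed_rational_cone (w l) (C l)) ->
  \sum_l ratfun_const n (a l) * HilbP (C l) = laurent_ratfun phi ->
  (forall l, dot zeta (lat R (w l)) < b -> zeta_pointed zeta (C l)) ->
  laurent_ratfun (laurent_restr phi zeta b) =
    \sum_(l | `[< zeta_pointed zeta (C l) >])
      ratfun_const n (a l) * HilbP (C l `&` hplane zeta b)
  /\
  (conv_hull R w `&` hplane zeta b = min_face zeta (conv_hull R w) ->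
   laurent_ratfun (laurent_restr phi zeta b) =
    \sum_(l | `[< zeta_pointed zeta (C l)
                  /\ min_face zeta (conv_hull R w) (lat R (w l)) >])
      ratfun_const n (a l) * HilbP (C l `&` hplane zeta b)).
Proof.
move=> Cpt phiE Cb.
have /choice[mv mvE] : forall l, exists mv : {m & 'I_m -> 'rV[int]_n},
    C l = [set lat R (w l) + y | y in cone_hull R (projT2 mv)].
  by move=> l; have [_ [m [v ->]]] := Cpt l; exists (existT _ m v).
have {mvE Cpt}CE : C = fun l => [set lat R (w l) + y | y in cone_hull R (projT2 (mv l))].
  exact/funext.
have first : laurent_ratfun (laurent_restr phi zeta b) =
    \sum_(l | `[< zeta_pointed zeta (C l) >])
      ratfun_const n (a l) * HilbP (C l `&` hplane zeta b).
  move: phiE; rewrite /HilbP /Hilb; case: pselect => [ex|_].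
    by case: (cid ex) => H /= HP phiE; move: phiE Cb; rewrite CE; apply: slice_Hilb HP.
  (* If no Hilbert map existed, [Hilb] would be the zero map by its default value: the hypothesis
     then gives phi = 0, and both sides of the formula vanish. *)
  rewrite big1 => [/esym/laurent_ratfun_inj0 phi0|l _]; last by rewrite mulr0.
  rewrite big1 => [|l _]; last by rewrite mulr0.
  apply: laurent_ratfun_eq0 => z; rewrite /laurent_restr fsfunE phi0.
  by rewrite !if_same.
split=> // face; rewrite first.
(* The two sums differ by the pointed cones whose apex lies off the minimal face; these start
   strictly above height b and miss the slice. *)
rewrite [LHS](bigID (fun l => `[< min_face zeta (conv_hull R w) (lat R (w l)) >])) /=.
rewrite [X in _ + X]big1 ?addr0.
  by apply: eq_bigl => l; rewrite asbool_and.
move=> l /andP[/asboolP lpt /asboolP nface].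
have wconv k : conv_hull R w (lat R (w k)).
  exists (fun i => (i == k)%:R); split=> //.
    by rewrite (bigD1 k) //= eqxx big1 ?addr0 // => i /negPf->.
  rewrite (bigD1 k) //= eqxx scale1r big1 ?addr0 // => i /negPf->.
  by rewrite scale0r.
(* Heights on the hull are weighted averages of apex heights. *)
have face_le k : (forall i, dot zeta (lat R (w k)) <= dot zeta (lat R (w i))) ->
    min_face zeta (conv_hull R w) (lat R (w k)).
  move=> kmin; split=> // _ [c [c0 c1 ->]].
  rewrite dot_sumr -[leLHS]mul1r -c1 mulr_suml; apply: ler_sum => i _.
  by rewrite ler_wpM2l.
have wb : b < dot zeta (lat R (w l)).
  (* k indexes an apex of least height; it lies on the minimal face, hence at height b by the
     assumption on the face. *)
  pose k := [arg min_(i < l) dot zeta (lat R (w i))]%O.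
  have kmin i : dot zeta (lat R (w k)) <= dot zeta (lat R (w i)).
    by rewrite /k; case: arg_minP => // j _; apply.
  have : (conv_hull R w `&` hplane zeta b) (lat R (w k)) by rewrite face; apply: face_le.
  move=> [_ kb]; rewrite -[b]kb ltNge; apply/negP => lk.
  by apply: nface; apply: face_le => i; apply: le_trans lk (kmin i).
have -> : C l `&` hplane zeta b = set0.
  rewrite CE; apply/seteqP; split=> // x [[y yC <-]]; rewrite /hplane /= => xb.
  move: lpt; rewrite CE => /zeta_pointed_gens/dot_cone_ge0/(_ yC).
  by move: xb; rewrite dotDr => xb y0; move: wb; rewrite -xb ltNge lerDl y0.
rewrite /HilbP /Hilb; case: pselect => [ex|_]; last by rewrite mulr0.
case: (cid ex) => H /= HP; rewrite (_ : indic set0 = fun=> 0) ?(is_Hilb0 HP) ?mulr0 //.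
by apply/funext => z; rewrite /indic asboolF.
Qed.
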